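(* Let $G$ be a finite simple cubic planar graph, embedded in the plane so that its outer face is bounded by a cycle, and let $\overline{G}$ be its dual graph, with outer vertex $\overline{v}^*$. Then $G$ has a Hamiltonian cycle if and only if there exists a tree $\overline{T}$ in $\overline{G}$ found by the Expansion Algorithm (that is, the tree $\overline{T}$ associated with some run of the Expansion Algorithm on $G$), with root $\overline{v}^*$, satisfying the following two properties: (1) For each vertex $v$ of $G$, if $v$ lies on the boundaries of the faces $f_{\overline{v}_1}, f_{\overline{v}_2}, f_{\overline{v}_3}$, then at least one of the vertices $\overline{v}_1,\overline{v}_2,\overline{v}_3$ of $\overline{G}$ lies on $\overline{T}$. (2) No two vertices on $\overline{T}$ are joined by an edge $\overline{e}$ of $\overline{G}$ unless $\overline{e}\in\overline{T}$.
   Context: Complementary path: for a cycle $\sigma$ in a plane graph $G$ and an edge $e=v_1v_2$ of $\sigma$, a complementary path $P_e^\sigma$ is a path in $G$ from $v_1$ to $v_2$ that is internally disjoint from $\sigma$ and such that $P_e^\sigma$ together with $e$ forms the boundary of a face of $G$. Sum of graphs: $(V_1,E_1)+(V_2,E_2):=(V_1\cup V_2,E_1\cup E_2)$; ''$-e$'' means deleting the edge $e$ (but no vertices). Expansion Algorithm: let $\sigma_0$ be the outer facial cycle of $G$ and $i=0$. As long as there is an edge $e_i\in\sigma_i$ for which a complementary path $P_{e_i}^{\sigma_i}$ exists, choose such an edge $e_i$, put $\sigma_{i+1}:=\sigma_i+P_{e_i}^{\sigma_i}-e_i$, and increase $i$ by one. When no such edge exists, output $\sigma_i$. The choices of the $e_i$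 are arbitrary, so different runs are possible. Dual graph: $\overline{G}=(\overline{V},\overline{E})$ has one vertex $\overline{v}$ for each face of $G$; the face corresponding to $\overline{v}$ is denoted $f_{\overline{v}}$. Each edge $e$ of $G$ that is a shared boundary edge of $f_{\overline{v}_1}$ and $f_{\overline{v}_2}$ gives a dual edge $\overline{e}$ between $\overline{v}_1$ and $\overline{v}_2$ (so parallel edges may occur in $\overline{G}$). The outer vertex $\overline{v}^*$ is the vertex of $\overline{G}$ corresponding to the outer face of $G$. Tree associated with a run: if $e_0,e_1,\dots,e_n$ are the edges chosen, in order, in a run of the Expansion Algorithm, then $\overline{T}=\bigcup_{i=0}^n\overline{e}_i$ is the subgraph of $\overline{G}$ formed by the dual edges and their end vertices; it starts from the root $\overline{v}^*$ (and is the single vertex $\overline{v}^*$ if no edge is chosen). *)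

(* Defs.v *)
From mathcomp Require Import all_boot perm.

Set Implicit Arguments.
Unset Strict Implicit.
Unset Printing Implicit Defensive.

Record sgraph := SGraph {
  vertex :> finType;
  adj : rel vertex;
  adj_sym : symmetric adj;
  adj_irrefl : irreflexive adj }.

Section Subgraphs.
Variable G : sgraph.

(* Edges are two-element vertex sets; a subgraph is a vertex set together     *)
(* with an edge set.                                                          *)
Definition edge := {set G}.

Definition edges : {set edge} :=
  [set [set a.1; a.2] | a : G * G & adj a.1 a.2].

Definition subgraph := ({set G} * {set edge})%type.

Definition graph_add (H K : subgraph) : subgraph :=
  (H.1 :|: K.1, H.2 :|: K.2).

Definition graph_del (H : subgraph) (e : edge) : subgraph := (H.1, H.2 :\ e).

Definition edge_graph (e : edge) : subgraph := (e, [set e]).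

Definition walk_graph (x : G) (p : seq G) : subgraph :=
  ([set:: x :: p], [set:: pairmap (fun u v => [set u; v]) x p]).

Definition is_path (u v : G) (P : subgraph) : Prop :=
  exists p : seq G,
    [/\ path (@adj G) u p, uniq (u :: p), last u p = v & P = walk_graph u p].

Definition is_cycle (C : subgraph) : Prop :=
  exists (x : G) (p : seq G),
    [/\ path.cycle (@adj G) (x :: p), uniq (x :: p), 2 < size (x :: p)
      & C = walk_graph x (rcons p x)].

Definition cubic : Prop := forall v : G, #|[set u | adj v u]| = 3.

Definition hamiltonian : Prop :=
  exists C : subgraph, is_cycle C /\ C.1 = [set: G].

(* A dart is an edge with a direction, from dtail to dhead.                   *)
Definition dart := {a : G * G | adj a.1 a.2}.
Definition dtail (d : dart) : G := (val d).1.
Definition dhead (d : dart) : G := (val d).2.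
Definition dedge (d : dart) : edge := [set dtail d; dhead d].

Lemma flip_subproof (d : dart) : adj (dhead d) (dtail d).
Proof. by rewrite adj_sym; exact: (valP d). Qed.

Definition flip (d : dart) : dart :=
  exist (fun a : G * G => adj a.1 a.2) (dhead d, dtail d) (flip_subproof d).

End Subgraphs.

(* Embeddings in the plane, up to homeomorphism, of a nonempty graph without  *)
(* isolated vertices; the graph need not be connected.                        *)
(* - rot d is the next dart clockwise after d among those leaving dtail d;    *)
(* - left d is the face lying to the left of d.  Walking along d and then     *)
(*   turning into rot (flip d) keeps the same face on the left.  The boundary *)
(*   of a face may consist of several such closed walks: this is how one      *)
(*   component of the graph sits inside a face of another.                    *)
(* With W boundary walks, F faces and c components, a connected dual graph    *)
(* gives W >= F + c - 1, and V - E + W <= 2c holds for every rotation system, *)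
(* so Euler's formula V - E + F = 1 + c forces equality in both: every        *)
(* component is embedded in the sphere, and the components and faces are      *)
(* arranged in a tree.  Choosing the outer face turns the sphere into the     *)
(* plane.                                                                     *)
Record plane_embedding (G : sgraph) := PlaneEmbedding {
  face : finType;
  outer : face;
  rot : {perm dart G};
  left : dart G -> face;
  rot_orbit : forall d : dart G,
    porbit rot d = [set d' | dtail d' == dtail d];
  left_walk : forall d : dart G, left (rot (flip d)) = left d;
  left_surj : forall f : face, exists d : dart G, left d = f;
  dual_connected : forall f f' : face,
    connect (fun g h => [exists d, (left d == g) && (left (flip d) == h)]) f f';
  euler_formula :
    #|G| + #|face| = #|edges G| + n_comp (@adj G) [set: G] + 1 }.

Section Expansion.
Variables (G : sgraph) (M : plane_embedding G).

Definition right (d : dart G) : face M := left M (flip d).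

(* An edge has two darts, so it bounds f as soon as f is to the left of one.  *)
Definition boundary (f : face M) : subgraph G :=
  ([set dtail d | d : dart G & left M d == f],
   [set dedge d | d : dart G & left M d == f]).

Definition complementary_path (sigma : subgraph G) (e : edge G)
    (P : subgraph G) : Prop :=
  exists v1 v2 : G,
    [/\ e = [set v1; v2],
        is_path v1 v2 P,
        P.1 :&: sigma.1 \subset [set v1; v2]
      & exists f : face M, graph_add P (edge_graph e) = boundary f].

(* expansion s sigma: the algorithm can choose the edges s, in this order,    *)
(* and then hold the cycle sigma.                                             *)
Inductive expansion : seq (edge G) -> subgraph G -> Prop :=
| ExpansionStart : expansion [::] (boundary (outer M))
| ExpansionStep s sigma e P :
    expansion s sigma -> e \in sigma.2 -> complementary_path sigma e P ->
    expansion (rcons s e) (graph_del (graph_add sigma P) e).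

Definition expansion_run (s : seq (edge G)) (sigma : subgraph G) : Prop :=
  expansion s sigma /\
  ~ (exists e P, e \in sigma.2 /\ complementary_path sigma e P).

(* The dual graph has vertex set face M, and its edge dual to e is            *)
(* represented by e itself.                                                   *)
Definition dual_ends (e : edge G) : {set face M} :=
  [set left M d | d : dart G & dedge d == e].

Definition dual_joins (e : edge G) (f1 f2 : face M) : bool :=
  (e \in edges G) && (dual_ends e == [set f1; f2]).

Definition dual_subgraph := ({set face M} * {set edge G})%type.

(* The dual is a multigraph, possibly with loops, so a cycle in it is given   *)
(* by darts, each read as crossing from its left face to its right face.      *)
Definition dual_cycle (c : seq (dart G)) : bool :=
  [&& c != [::], path.cycle (fun d d' => right d == left M d') c,
      uniq (map (left M) c) & uniq (map (@dedge G) c)].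

Definition is_dual_tree (T : dual_subgraph) : Prop :=
  [/\ T.1 != set0,
      forall e, e \in T.2 -> e \in edges G /\ dual_ends e \subset T.1,
      {in T.1 &, forall f f',
        connect (fun g h => [exists e in T.2, dual_joins e g h]) f f'}
    & forall c, {in c, forall d, dedge d \in T.2} -> ~~ dual_cycle c].

Definition expansion_tree (s : seq (edge G)) : dual_subgraph :=
  (outer M |: \bigcup_(e <- s) dual_ends e, [set:: s]).

Definition found_by_expansion (T : dual_subgraph) : Prop :=
  exists s sigma, expansion_run s sigma /\ T = expansion_tree s.

End Expansion.

(* Main.v *)
Require Import Defs.
From mathcomp Require Import all_boot perm.
From mathcomp Require Import zify.

(** If the algorithm has crossed the edges [s], then the vertices of its cycle
    are those of the faces of the tree; so condition (1) makes the final cycle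
    Hamiltonian.

    Conversely, let [C] be a Hamiltonian cycle, call the other edges chords, and
    let [F] be the number of faces.  By Euler's formula there are [F - 2] chords.
    Turning around a vertex of [C], one crosses only chords between the faces on
    one side of [C], so in the dual graph every face is joined through chords to
    one of the two sides.  A multigraph with [F - 2] edges has at least two
    components, and more than two if some edge is not a bridge; hence the two
    sides are not joined and every chord is a bridge.  The same count on boundary
    walks instead of faces shows that each face has a single boundary walk.
    Starting from the outer face, the algorithm can thus add the faces on the
    outer side of [C] one by one through chords: a new face that met the current
    cycle outside the ends of the crossed chord would share a second chord with
    the tree, and that chord would not be a bridge. *)

Set Implicit Arguments.
Unset Strict Implicit.
Unset Printing Implicit Defensive.

Lemma eq_set2 (T : finType) (a b c d : T) :
  [set a; b] = [set c; d] -> (a = c /\ b = d) \/ (a = d /\ b = c).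
Proof.
move=> eq2.
have /set2P a_cd : a \in [set c; d] by rewrite -eq2 set21.
have /set2P b_cd : b \in [set c; d] by rewrite -eq2 set22.
have /set2P c_ab : c \in [set a; b] by rewrite eq2 set21.
have /set2P d_ab : d \in [set a; b] by rewrite eq2 set22.
by case: a_cd; case: b_cd; case: c_ab; case: d_ab => *; subst; auto.
Qed.

(** * Components of a multigraph given by a list of pairs *)

Section Spanning.
Variable T : finType.

Definition pair_link (s : seq (T * T)) : rel T :=
  fun x y => ((x, y) \in s) || ((y, x) \in s).

Lemma pair_link_sym s : symmetric (pair_link s).
Proof. by move=> x y; rewrite /pair_link orbC. Qed.

(** A path is cut at its first and last use of the new pair. *)
Lemma connect_pair_link_cons a b s x y :
  connect (pair_link ((a, b) :: s)) x y ->
  connect (pair_link s) x y \/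
  (connect (pair_link s) x a \/ connect (pair_link s) x b) /\
  (connect (pair_link s) a y \/ connect (pair_link s) b y).
Proof.
move/connectP=> [p]; elim: p x => [|z p IHp] x /=; first by move=> _ ->; left; exact: connect0.
move=> /andP[xz pz] /(IHp _ pz) {IHp pz}.
have [xzs|] := boolP (pair_link s x z).
  have xz' := connect1 xzs.
  case=> [zy|[zab aby]]; first by left; apply: connect_trans zy.
  by right; split=> //; case: zab => zab; [left|right]; apply: connect_trans zab.
move=> /norP[/negPf xzN /negPf zxN] zy; move: xz.
rewrite {1}/pair_link !inE !xpair_eqE xzN zxN !orbF.
case/orP=> /andP[/eqP eq1 /eqP eq2]; subst.
  right; split; first by left; exact: connect0.
  by case: zy => [|[]] //; right.
right; split; first by right; exact: connect0.
by case: zy => [|[]] //; left.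
Qed.

(** Removing one pair splits at most one component in two, which costs at most one more
    representative. *)
Lemma card_connected_le s (X R : {set T}) :
  (forall x, x \in X -> exists2 r, r \in R & connect (pair_link s) x r) ->
  #|X| <= #|R| + size s.
Proof.
elim: s R => [|[a b] s IHs] R XR.
  rewrite addn0; apply/subset_leq_card/subsetP=> x /XR[r rR].
  by case/connectP=> [[|y p]] //= _ rx; rewrite rx in rR.
have symc := sym_connect_sym (pair_link_sym s).
(* If [a] still reaches [R] without the pair, only what hangs on [b] may be cut off. Otherwise any
   connection to [R] through the pair leaves it from [b], and [a] is added. *)
pose c := if [exists r in R, connect (pair_link s) a r] then b else a.
suff /IHs : forall x, x \in X ->
    exists2 r, r \in c |: R & connect (pair_link s) x r.
  by move=> le1; apply: leq_trans le1 _; rewrite cardsU1 /=; case: (_ \notin _); lia.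
move=> x /XR[r rR /connect_pair_link_cons[xr|[xab abr]]].
  by exists r; rewrite // inE rR orbT.
rewrite /c; case: ifP => [/exists_inP[r' r'R ar']|/exists_inPn nar].
  case: xab => [xa|xb]; last by exists b; rewrite ?setU11.
  by exists r'; rewrite ?inE ?r'R ?orbT //; apply: connect_trans ar'.
have br : connect (pair_link s) b r.
  by case: abr => // ar; move: (nar r rR); rewrite ar.
case: xab => [xa|xb]; first by exists a; rewrite ?setU11.
by exists r; rewrite ?inE ?rR ?orbT //; apply: connect_trans br.
Qed.

End Spanning.

(** * Darts and their edges *)

Section Darts.
Variable G : sgraph.
Implicit Types (d : dart G) (e : edge G).

Lemma flipK : involutive (@flip G).
Proof. by move=> [[u v] uv]; apply: val_inj. Qed.

Lemma dhead_flip d : dhead (flip d) = dtail d. Proof. by []. Qed.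

Lemma dedge_flip d : dedge (flip d) = dedge d.
Proof. by rewrite /dedge setUC. Qed.

Lemma dtail_neq_dhead d : dtail d != dhead d.
Proof.
apply/eqP=> th; have := valP d.
by rewrite -[(val d).1]/(dtail d) th -[(val d).2]/(dhead d) adj_irrefl.
Qed.

Lemma dart_eq d d' : dtail d = dtail d' -> dhead d = dhead d' -> d = d'.
Proof.
move=> tt hh; apply: val_inj; rewrite [val d]surjective_pairing.
by rewrite [val d']surjective_pairing; congr pair.
Qed.

Lemma dedge_inj d d' : dedge d = dedge d' -> d' = d \/ d' = flip d.
Proof. by case/eq_set2=> -[t h]; [left|right]; apply: dart_eq. Qed.

Lemma dedge_in_edges d : dedge d \in edges G.
Proof. by apply/imsetP; exists (val d) => //; rewrite inE (valP d). Qed.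

Lemma edgesP e : reflect (exists d, e = dedge d) (e \in edges G).
Proof.
apply: (iffP imsetP) => [[a a_adj ->]|[d ->]]; last first.
  by exists (val d) => //; rewrite inE (valP d).
by rewrite inE in a_adj; exists (exist _ a a_adj).
Qed.

End Darts.

(** * Rotation around a vertex of degree three *)

Section CubicRotation.
Variables (G : sgraph) (M : plane_embedding G).
Hypothesis Gcubic : cubic G.
Implicit Types (d y z : dart G).

Lemma dtail_rot d : dtail (Defs.rot M d) = dtail d.
Proof.
have : Defs.rot M d \in porbit (Defs.rot M) d := mem_porbit (Defs.rot M) 1 d.
by rewrite rot_orbit inE => /eqP.
Qed.

Lemma card_porbit_rot d : #|porbit (Defs.rot M) d| = 3.
Proof.
rewrite rot_orbit -(Gcubic (dtail d)) -[LHS](@card_in_imset _ _ (@dhead G)).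
  apply: eq_card => u; rewrite inE; apply/imsetP/idP => [[d']|du].
    by rewrite inE => /eqP <- ->; exact: (valP d').
  by exists (exist (fun a : G * G => adj a.1 a.2) (dtail d, u) du); rewrite ?inE.
by move=> x y; rewrite !inE => /eqP tx /eqP ty; apply: dart_eq; rewrite tx ty.
Qed.

Lemma rot3 d : Defs.rot M (Defs.rot M (Defs.rot M d)) = d.
Proof. by rewrite -{2}(iter_porbit (Defs.rot M) d) card_porbit_rot. Qed.

Lemma rot_neq d : Defs.rot M d != d.
Proof.
have := uniq_traject_porbit (Defs.rot M) d; rewrite card_porbit_rot /= !inE eq_sym.
by case: eqP.
Qed.

Lemma rot_cases y z : dtail y = dtail z ->
  [\/ z = y, z = Defs.rot M y | z = Defs.rot M (Defs.rot M y)].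
Proof.
move=> tyz; have : z \in porbit (Defs.rot M) y by rewrite rot_orbit inE tyz.
rewrite porbit_traject card_porbit_rot !inE.
by case/or3P=> /eqP; [apply: Or31|apply: Or32|apply: Or33].
Qed.

Lemma rot_or y z : dtail y = dtail z -> y <> z ->
  z = Defs.rot M y \/ y = Defs.rot M z.
Proof. by move=> /rot_cases[] ->; rewrite ?rot3; auto. Qed.

End CubicRotation.

Definition face_next (G : sgraph) (M : plane_embedding G) (d : dart G) :=
  Defs.rot M (flip d).

(** * Dual connectivity through a set of edges *)

Section Crossing.
Variables (G : sgraph) (T : finType) (L : dart G -> T).
Implicit Types (d : dart G) (A B : {set edge G}).

(** The label [L] is left general: it is instantiated both with the face on the left of a dart and
    with the boundary walk containing it. *)
Definition crossing A : rel T :=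
  fun x y => [exists d, [&& L d == x, L (flip d) == y & dedge d \in A]].

Lemma crossing_dart A d : dedge d \in A -> crossing A (L d) (L (flip d)).
Proof. by move=> dA; apply/existsP; exists d; rewrite !eqxx. Qed.

Lemma crossing_sym A : symmetric (crossing A).
Proof.
suff sym x y : crossing A x y -> crossing A y x.
  by move=> x y; apply/idP/idP; apply: sym.
case/existsP=> d /and3P[/eqP <- /eqP <- dA].
by rewrite -{2}(flipK d) crossing_dart // dedge_flip.
Qed.

Lemma connect_crossing_sym A : connect_sym (crossing A).
Proof. exact/sym_connect_sym/crossing_sym. Qed.

Lemma connect_crossingS A B :
  A \subset B -> subrel (connect (crossing A)) (connect (crossing B)).
Proof.
move=> /subsetP AB; apply: connect_sub => x y.
case/existsP=> d /and3P[/eqP <- /eqP <- dA].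
by rewrite connect1 // crossing_dart // AB.
Qed.

Lemma card_crossing_le A (X R : {set T}) : A \subset edges G ->
  (forall x, x \in X -> exists2 r, r \in R & connect (crossing A) x r) ->
  #|X| <= #|R| + #|A|.
Proof.
move=> /subsetP AE XR; have [->|[x0 /XR[r0 r0R _]]] := set_0Vmem X.
  by rewrite cards0.
(* The two darts of an edge give the same pair up to order, so one of them is picked. The default is
   never returned for an edge. *)
pose ends e := odflt (r0, r0) [pick a | [exists d, (dedge d == e) &&
  (a == (L d, L (flip d)))]].
have endsP d : dedge d \in A ->
    ends (dedge d) = (L d, L (flip d)) \/ ends (dedge d) = (L (flip d), L d).
  move=> dA; rewrite /ends; case: pickP => [a|/(_ (L d, L (flip d)))]; last first.
    by case/existsP; exists d; rewrite !eqxx.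
  case/existsP=> d' /andP[/eqP dd' /eqP ->] /=.
  by case: (dedge_inj (esym dd')) => ->; [left|right; rewrite flipK].
rewrite (cardE A) -(size_map ends); apply: card_connected_le => x /XR[r rR xr].
exists r => //; apply: connect_sub xr => y z.
case/existsP=> d /and3P[/eqP <- /eqP <- dA]; apply: connect1; rewrite /pair_link.
have /(map_f ends) : dedge d \in enum A by rewrite mem_enum.
by case: (endsP d dA) => -> ->; rewrite ?orbT.
Qed.

End Crossing.

(** * Invariants of the Expansion Algorithm *)

Section Expanding.
Variables (G : sgraph) (M : plane_embedding G).
Hypothesis Gcubic : cubic G.
Implicit Types (d : dart G) (v : G) (f : face M) (P sigma : subgraph G).

Local Notation left := (left M).

Lemma dual_ends_dart d : dual_ends M (dedge d) = [set left d; left (flip d)].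
Proof.
apply/setP=> f; apply/imsetP/set2P=> [[d']|[] ->].
- by rewrite inE => /eqP/esym/dedge_inj[] -> ->; auto.
- by exists d; rewrite ?inE.
- by exists (flip d); rewrite ?inE ?dedge_flip.
Qed.

Lemma boundary_vertexP f v :
  reflect (exists2 d, v = dtail d & left d = f) (v \in (boundary f).1).
Proof.
apply: (iffP imsetP) => [[d]|[d -> df]]; last by exists d; rewrite ?inE ?df.
by rewrite inE => /eqP df ->; exists d.
Qed.

Lemma boundary_edgeP f (e : edge G) :
  reflect (exists2 d, e = dedge d & left d = f) (e \in (boundary f).2).
Proof.
apply: (iffP imsetP) => [[d]|[d -> df]]; last by exists d; rewrite ?inE ?df.
by rewrite inE => /eqP df ->; exists d.
Qed.

Lemma dtail_boundary d : dtail d \in (boundary (left d)).1.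
Proof. by apply/boundary_vertexP; exists d. Qed.

Lemma dtail_face_next d : dtail (face_next M d) = dhead d.
Proof. by rewrite dtail_rot. Qed.

Lemma left_face_next d : left (face_next M d) = left d.
Proof. exact: left_walk. Qed.

Lemma dhead_boundary d : dhead d \in (boundary (left d)).1.
Proof. by rewrite -left_face_next -dtail_face_next dtail_boundary. Qed.

(** If two successive darts of a boundary walk stayed within two vertices, the second would be the
    flip of the first, and the rotation would have a fixed point. *)
Lemma boundary_not_in_edge f (v1 v2 : G) :
  ~~ ((boundary f).1 \subset [set v1; v2]).
Proof.
have [d <-] := left_surj f; apply/negP=> /subsetP sub12; pose d' := face_next M d.
have := sub12 _ (dtail_boundary d); have := sub12 _ (dhead_boundary d).
have := dhead_boundary d'; rewrite left_face_next => /sub12.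
have := dtail_neq_dhead d'; have := dtail_neq_dhead d.
rewrite [dtail d']dtail_face_next => /eqP th /eqP th' h' h t.
have hd' : dhead d' = dtail d.
  by case/set2P: h' th'; case/set2P: h th; case/set2P: t => -> -> // ? ->.
have : d' = flip d by apply: dart_eq; rewrite ?dtail_face_next.
by apply/eqP/rot_neq.
Qed.

Lemma path_ends (u w : G) P : is_path u w P -> u \in P.1 /\ w \in P.1.
Proof.
case=> p [_ _ <- ->]; rewrite inE mem_head; split=> //.
by rewrite inE; exact: mem_last.
Qed.

(** Otherwise the path would have only its two ends as vertices, and so would the boundary of the
    face it closes. *)
Lemma complementary_path_leaves sigma e P :
  complementary_path M sigma e P -> ~~ (P.1 \subset sigma.1).
Proof.
case=> v1 [v2] [-> /path_ends[Pv1 Pv2] int12 [f Pf]]; apply/negP=> /setIidPl Psigma.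
rewrite Psigma in int12; have /negP := boundary_not_in_edge f v1 v2; case.
by rewrite -Pf subUset int12 /=.
Qed.

Lemma expansion_tree_rcons s e :
  (expansion_tree M (rcons s e)).1 = (expansion_tree M s).1 :|: dual_ends M e.
Proof. by rewrite /= -cats1 big_cat big_seq1 setUA. Qed.

Lemma complementary_path_sub sigma e P :
  complementary_path M sigma e P -> e \subset P.1.
Proof.
by case=> v1 [v2] [-> /path_ends[Pv1 Pv2] _ _]; rewrite subUset !sub1set Pv1.
Qed.

(* The new face has a vertex off sigma, so it is not yet in the tree; thus e   *)
(* separates it from a face of the tree.                                      *)
Lemma expansion_step s sigma e P :
  (forall e, e \in sigma.2 ->
     exists2 d, e = dedge d & left d \in (expansion_tree M s).1) ->
  sigma.1 = \bigcup_(f in (expansion_tree M s).1) (boundary f).1 ->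
  e \in sigma.2 -> complementary_path M sigma e P ->
  exists2 f, (expansion_tree M (rcons s e)).1 = f |: (expansion_tree M s).1 &
    graph_add P (edge_graph e) = boundary f.
Proof.
move=> sideP vertP /sideP[d -> dD] cP.
have := complementary_path_leaves cP; have := complementary_path_sub cP.
case: (cP) => v1 [v2] [_ _ _ [f Pf]] eP leaves; exists f => //.
have fD : f \notin (expansion_tree M s).1.
  apply: contra leaves => fD; rewrite vertP (subset_trans _ (bigcup_sup f fD)) //.
  by rewrite -Pf subsetUl.
have /boundary_edgeP[d' /dedge_inj dd' d'f] : dedge d \in (boundary f).2.
  by rewrite -Pf !inE eqxx orbT.
rewrite expansion_tree_rcons dual_ends_dart setUC.
case: dd' => d'E; first by rewrite -d'f d'E dD in fD.
have /setUidPr leftD : [set left d] \subset (expansion_tree M s).1 by rewrite sub1set.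
by rewrite -d'E d'f [[set _; f]]setUC -setUA leftD.
Qed.

(** The second part serves both implications; the first carries the induction, by showing that each
    step starts from a face of the tree. *)
Lemma expansion_sides s sigma : expansion M s sigma ->
  (forall e, e \in sigma.2 ->
     exists2 d, e = dedge d & left d \in (expansion_tree M s).1) /\
  sigma.1 = \bigcup_(f in (expansion_tree M s).1) (boundary f).1.
Proof.
elim=> {s sigma} [|s sigma e P _ [sideP vertP] esigma cP].
  have -> : (expansion_tree M [::]).1 = [set outer M] by rewrite /= big_nil setU0.
  split; last by rewrite big_set1.
  by move=> e /boundary_edgeP[d -> df]; exists d; rewrite // df set11.
have [f -> Pf] := expansion_step sideP vertP esigma cP.
split=> [e'|]; last first.
  rewrite bigcup_setU big_set1 -vertP -Pf /= setUC.
  by rewrite (setUidPl (complementary_path_sub cP)).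
rewrite !inE => /andP[_ /orP[/sideP[d -> dD]|e'P]].
  by exists d => //; exact: setU1r.
have /boundary_edgeP[d -> df] : e' \in (boundary f).2 by rewrite -Pf inE e'P.
by exists d; rewrite // df setU11.
Qed.

(** With [x] and [y] the same dart of a dual cycle, the other darts connect its two faces, so its
    edge is not a bridge. *)
Lemma dual_path_crossing (A : {set edge G}) x y c :
  path (fun d d' => right M d == left d') x (rcons c y) ->
  {in c, forall d, dedge d \in A} ->
  connect (crossing left A) (right M x) (left y).
Proof.
elim: c x => [|z c IHc] x /=; first by case/andP=> /eqP ->.
case/andP=> /eqP -> pz cA; apply: connect_trans (IHc z pz _).
  by apply/connect1/crossing_dart/cA; rewrite mem_head.
by move=> d dc; apply: cA; rewrite inE dc orbT.
Qed.

End Expanding.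

(** * The dual of a cubic plane graph with a Hamiltonian cycle *)

Section HamiltonianDual.
Variables (G : sgraph) (M : plane_embedding G) (nx : G -> G).
Hypotheses (Gcubic : cubic G) (nx_inj : injective nx).
Hypotheses (nx_adj : forall u, adj u (nx u)) (nx_nx : forall u, nx (nx u) != u).
Hypothesis nx_connect : forall u v, fconnect nx u v.
Implicit Types (d y z : dart G) (u v : G).

Local Notation F := (face M).
Local Notation left := (left M).

(** The Hamiltonian cycle is given by its successor function [nx]. The darts [fwd u] have one side
    of it on their left, their flips the other. *)
Definition fwd u : dart G :=
  exist (fun a : G * G => adj a.1 a.2) (u, nx u) (nx_adj u).

Definition cycle_edges : {set edge G} := [set dedge (fwd u) | u : G].

Definition chords : {set edge G} := edges G :\: cycle_edges.

Lemma dtail_fwd u : dtail (fwd u) = u. Proof. by []. Qed.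

Lemma dtail_flip_fwd u : dtail (flip (fwd u)) = nx u. Proof. by []. Qed.

Lemma fwd_cycle u : dedge (fwd u) \in cycle_edges.
Proof. exact: imset_f. Qed.

Lemma chordsE d : (dedge d \in chords) = (dedge d \notin cycle_edges).
Proof. by rewrite inE dedge_in_edges andbT. Qed.

Lemma chords_edges : chords \subset edges G. Proof. exact: subsetDl. Qed.

Lemma cycle_dartP d : dedge d \in cycle_edges ->
  exists u, d = fwd u \/ d = flip (fwd u).
Proof. by case/imsetP=> u _ /esym/dedge_inj; exists u. Qed.

Lemma card_cycle_edges : #|cycle_edges| = #|G|.
Proof.
rewrite card_imset // => u v /dedge_inj[/(congr1 (@dtail G)) //|vu].
have vE : v = nx u := congr1 (@dtail G) vu.
have /eqP : nx v = u := congr1 (@dhead G) vu.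
by rewrite vE (negPf (nx_nx u)).
Qed.

(** Of three cycle darts at a vertex, two would run in the same direction along the cycle, and these
    coincide because [nx] is injective. *)
Lemma chord3 y z w : dtail y = dtail z -> dtail z = dtail w ->
  y <> z -> z <> w -> w <> y ->
  dedge y \in cycle_edges -> dedge z \in cycle_edges -> dedge w \in chords.
Proof.
move=> yz zw nyz nzw nwy /cycle_dartP[a ya] /cycle_dartP[b zb].
rewrite chordsE; apply/negP => /cycle_dartP[c wc].
case: ya => ya; case: zb => zb; case: wc => wc; subst y z w;
  rewrite ?dtail_fwd ?dtail_flip_fwd in yz zw;
  try (move/nx_inj: yz => yz); try (move/nx_inj: zw => zw); subst; auto;
  by move/nx_inj: zw nwy => ->.
Qed.

(** Euler's formula: the cycle makes the graph connected and has as many edges as there are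
    vertices. *)
Lemma card_chords : #|chords| + 2 = #|F|.
Proof.
have [d0|noG] := pickP (@predT (dart G)); last first.
  by have [d] := left_surj (outer M); have := noG d.
have connected : n_comp (@adj G) [set: G] = 1.
  have adjC := sym_connect_sym (@adj_sym G).
  rewrite -(n_comp_connect adjC (dtail d0)); apply: eq_n_comp_r => v.
  rewrite inE; apply/esym/(connect_sub _ (nx_connect (dtail d0) v)) => x y /eqP <-.
  exact/connect1/nx_adj.
have := euler_formula M; rewrite connected -card_cycle_edges.
have CE : cycle_edges \subset edges G.
  by apply/subsetP=> e /imsetP[u _ ->]; exact: dedge_in_edges.
have := cardsID cycle_edges (edges G); rewrite (setIidPr CE) /chords; lia.
Qed.

(** * Every face is joined through chords to a side of the cycle *)

Section Sides.
Variables (T : finType) (L : dart G -> T).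
Hypothesis L_next : forall d, L (face_next M d) = L d.

(** Rotating from [y] to [z] either meets no dart in between, and the labels agree, or passes over
    the third dart, which is a chord. *)
Lemma turn y z : dtail y = dtail z -> y <> z ->
  dedge y \in cycle_edges -> dedge z \in cycle_edges ->
  connect (crossing L chords) (L (flip y)) (L z).
Proof.
move=> yz nyz yC zC; have Lrot d : L (Defs.rot M d) = L (flip d).
  by rewrite -[in RHS]L_next /face_next flipK.
case: (rot_or M Gcubic yz nyz) => zE; first by rewrite zE Lrot.
have rry : Defs.rot M (Defs.rot M y) = z by rewrite zE rot3.
have := chord3 (y := y) (z := z) (w := Defs.rot M y).
rewrite dtail_rot yz => /(_ erefl erefl nyz) ryN.
rewrite -Lrot -[z]rry (Lrot (Defs.rot M y)); apply/connect1/crossing_dart/ryN => //.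
  by move=> zry; have /eqP := rot_neq M Gcubic z; rewrite -{2}rry -zry.
by apply/eqP; exact: rot_neq.
Qed.

Lemma fwd_neq_flip u : fwd (nx u) <> flip (fwd u).
Proof.
move/(congr1 (@dhead G)); rewrite dhead_flip dtail_fwd => /eqP.
by rewrite (negPf (nx_nx u)).
Qed.

(** Along the cycle one turns at [nx w] from [flip (fwd w)] to [fwd (nx w)]. *)
Lemma connect_left_side u v :
  connect (crossing L chords) (L (fwd u)) (L (fwd v)).
Proof.
rewrite -(iter_findex (nx_connect u v)).
elim: (findex _ _ _) => [|k IHk] //=; apply: connect_trans IHk _.
set w := iter _ _ _; rewrite -{1}(flipK (fwd w)).
apply: turn; rewrite ?dedge_flip ?fwd_cycle //.
by move=> /esym/fwd_neq_flip.
Qed.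

Lemma connect_right_side u v :
  connect (crossing L chords) (L (flip (fwd u))) (L (flip (fwd v))).
Proof.
(* On the right the turns lead backwards along the cycle. *)
rewrite -(iter_findex (nx_connect u v)) connect_crossing_sym.
elim: (findex _ _ _) => [|k IHk] //=; apply: connect_trans IHk.
set w := iter _ _ _; apply: turn; rewrite ?dedge_flip ?fwd_cycle //.
exact: fwd_neq_flip.
Qed.

(** A chord dart is next to [fwd v] in the rotation at its tail [v]: it either shares the label
    right of [fwd v], or reaches the label left of it by crossing its own edge. *)
Lemma connect_some_side u d :
  connect (crossing L chords) (L d) (L (fwd u)) \/
  connect (crossing L chords) (L d) (L (flip (fwd u))).
Proof.
have [dC|] := boolP (dedge d \in cycle_edges).
  case: (cycle_dartP dC) => v [] ->; first by left; exact: connect_left_side.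
  by right; exact: connect_right_side.
rewrite -chordsE => dN; pose v := dtail d.
have [dE|/eqP nvd] := eqVneq (fwd v) d.
  by move: dN; rewrite -dE chordsE fwd_cycle.
case: (rot_or M Gcubic (erefl : dtail (fwd v) = dtail d) nvd) => [->|vE].
  right; rewrite -{1}(flipK (fwd v)).
  by rewrite -/(face_next M _) L_next; exact: connect_right_side.
left; apply: connect_trans (connect_left_side v u).
rewrite vE -{2}(flipK d) -/(face_next M _) L_next.
exact/connect1/crossing_dart.
Qed.

End Sides.

(** * Each face has a single boundary walk *)

Lemma card_walks_le (T : finType) (L : dart G -> T) :
  (forall d, L (face_next M d) = L d) -> #|[set L d | d : dart G]| <= #|F|.
Proof.
move=> L_next; have [d0 _] := left_surj (outer M); pose u := dtail d0.
rewrite -card_chords addnC.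
apply: leq_trans (card_crossing_le (L := L) (R := [set L (fwd u); L (flip (fwd u))])
  chords_edges _) _; last by rewrite leq_add2r cards2; case: eqP.
move=> x /imsetP[d _ ->].
case: (connect_some_side L_next u d) => c; [exists (L (fwd u))|exists (L (flip (fwd u)))];
  by rewrite ?set21 ?set22.
Qed.

Lemma face_next_inj : injective (face_next M).
Proof. by move=> d d' /perm_inj /(can_inj (@flipK G)). Qed.

(** The roots of the [face_next] orbits stand for the boundary walks. Mapping them to faces is onto,
    and by [card_walks_le] there are no more walks than faces, so it is injective. *)
Lemma single_walk d d' : left d = left d' -> fconnect (face_next M) d d'.
Proof.
have fsym := fconnect_sym face_next_inj.
have rootP d1 d2 := root_connect fsym d1 d2.
have root_next x : froot (face_next M) (face_next M x) = froot (face_next M) x.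
  by apply/eqP; rewrite rootP fsym; exact: fconnect1.
pose W := [set froot (face_next M) x | x : dart G].
have left_root x : left (froot (face_next M) x) = left x.
  have /iter_findex <- : fconnect (face_next M) x (froot (face_next M) x).
    exact: connect_root.
  by elim: (findex _ _ _) => //= k; rewrite left_face_next.
have leftW : [set left x | x in W] = [set: F].
  apply/setP=> f; rewrite inE; have [x <-] := left_surj f.
  by rewrite -left_root; apply/imset_f/imset_f.
have /imset_injP injW : #|[set left x | x in W]| == #|W|.
  by rewrite eqn_leq leq_imset_card leftW cardsT card_walks_le.
move=> dd'; rewrite -rootP; apply/eqP/injW; rewrite ?left_root //; exact: imset_f.
Qed.

(** Otherwise a single representative would suffice, and the [#|F| - 2] chords would connect all
    [#|F|] faces. *)
Lemma sides_apart u :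
  ~~ connect (crossing left chords) (left (fwd u)) (left (flip (fwd u))).
Proof.
apply/negP=> lr; have := card_chords.
suff : #|F| <= 1 + #|chords| by lia.
rewrite -cardsT -(cards1 (left (fwd u))).
apply: (card_crossing_le (L := left) chords_edges) => f _.
exists (left (fwd u)); rewrite ?inE //; have [d <-] := left_surj f.
case: (connect_some_side (left_face_next M) u d) => // /connect_trans; apply.
by rewrite connect_crossing_sym.
Qed.

(** Otherwise two representatives and [#|F| - 3] chords would reach all [#|F|] faces. *)
Lemma chord_bridge d : dedge d \in chords ->
  ~~ connect (crossing left (chords :\ dedge d)) (left d) (left (flip d)).
Proof.
move=> dN; apply/negP=> lr; have := card_chords.
suff : #|F| <= 2 + #|chords :\ dedge d|.
  rewrite (cardsD1 (dedge d) chords) dN => + eqF.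
  by rewrite -eqF addnC leq_add2l add1n ltnn.
pose u := dtail d; pose R := [set left (fwd u); left (flip (fwd u))].
have /leq_trans-> // : #|F| <= #|R| + #|chords :\ dedge d|; last first.
  by rewrite leq_add2r cards2; case: eqP.
(* Each use of the removed chord is replaced by the detour [lr]. *)
have stay : subrel (connect (crossing left chords))
                   (connect (crossing left (chords :\ dedge d))).
  apply: connect_sub => x y /existsP[d' /and3P[/eqP <- /eqP <- d'N]].
  have [/dedge_inj[] ->|nd] := eqVneq (dedge d) (dedge d'); first by [].
    by rewrite flipK connect_crossing_sym.
  by apply/connect1/crossing_dart; rewrite in_setD1 eq_sym nd.
rewrite -cardsT; apply: (card_crossing_le (L := left)) => [|f _].
  exact/(subset_trans _ chords_edges)/subD1set.
have [d' <-] := left_surj f.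
case: (connect_some_side (left_face_next M) u d') => /stay c;
  [exists (left (fwd u))|exists (left (flip (fwd u)))]; by rewrite /R ?set21 ?set22.
Qed.

(** * Face boundaries are simple cycles *)

Lemma left_neq_right d : left d != left (flip d).
Proof.
apply/eqP=> dd; have [dC|] := boolP (dedge d \in cycle_edges).
  case: (cycle_dartP dC) dd => u [] ->; last rewrite flipK; move=> dd;
    by have := sides_apart u; rewrite dd connect0.
by rewrite -chordsE => /chord_bridge; rewrite dd connect0.
Qed.

(** Two darts of a face entering the same vertex have neighbouring flips in the rotation, which puts
    that face on both sides of one of them. *)
Lemma dhead_face_inj d d' : left d = left d' -> dhead d = dhead d' -> d = d'.
Proof.
suff turn_back x y : left x = left y -> flip y <> Defs.rot M (flip x).
  move=> ld hd; have [/(can_inj (@flipK G))//|/eqP nfd] := eqVneq (flip d) (flip d').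
  have tt : dtail (flip d) = dtail (flip d') := hd.
  by case: (rot_or M Gcubic tt nfd) => /turn_back; case.
move=> xy yx; have /eqP[] := left_neq_right y.
by rewrite yx -/(face_next M x) (left_face_next M).
Qed.

Lemma face_path_adj x q : fpath (face_next M) x q ->
  path (@adj G) (dhead x) (map (@dhead G) q) /\
  pairmap (fun u v => [set u; v]) (dhead x) (map (@dhead G) q) = map (@dedge G) q.
Proof.
elim: q x => //= y q IHq x /andP[/eqP <- /IHq[pq ->]].
have t := dtail_face_next M x.
split; last by congr (_ :: _); rewrite /dedge t.
by rewrite pq andbT -t; exact: (valP (face_next M x)).
Qed.

(** The boundary walk of the right face starts with [flip d], and its other darts form the path. It
    is the whole boundary by [single_walk] and repeats no vertex by [dhead_face_inj]. *)
Lemma face_path d : exists2 P, is_path (dtail d) (dhead d) P &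
  graph_add P (edge_graph (dedge d)) = boundary (right M d).
Proof.
pose x := flip d; set f := right M d.
have [q xq] : exists q, orbit (face_next M) x = x :: q.
  by rewrite /orbit -orderSpred; eexists.
have mem_xq y : (y \in x :: q) = (left y == f).
  rewrite -xq -fconnect_orbit; apply/idP/eqP=> [/iter_findex <-|yf].
    by elim: (findex _ _ _) => //= k; rewrite left_face_next.
  exact: single_walk.
have := cycle_orbit face_next_inj x; rewrite xq /= rcons_path => /andP[pq /eqP lastq].
have [adjq edgeq] := face_path_adj pq.
have heads : [set:: map (@dhead G) (x :: q)] = (boundary f).1.
  apply/setP=> v; rewrite inE; apply/mapP/boundary_vertexP => [[y yq ->]|[y -> yf]].
    exists (face_next M y); first by rewrite dtail_face_next.
    by rewrite left_face_next; apply/eqP; rewrite -mem_xq.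
  (* The predecessor of [y] on the boundary walk. *)
  pose z := flip ((Defs.rot M)^-1%g y).
  have zy : face_next M z = y by rewrite /face_next flipK permKV.
  by exists z; rewrite -?zy ?dtail_face_next // mem_xq -left_face_next zy yf.
exists (walk_graph (dhead x) (map (@dhead G) q)).
  exists (map (@dhead G) q); split=> //.
    rewrite -[_ :: _]/(map (@dhead G) (x :: q)) map_inj_in_uniq -xq ?orbit_uniq //.
    move=> y z; rewrite xq !mem_xq => /eqP yf /eqP zf; apply: dhead_face_inj.
    by rewrite yf zf.
  by rewrite -[dtail d]/(dhead x) last_map -(dtail_face_next M) lastq.
rewrite /graph_add /walk_graph /= edgeq [boundary f]surjective_pairing; congr pair.
  rewrite -heads; apply/setUidPl/subsetP => v.
  by rewrite heads => /set2P[] ->; [exact: (dhead_boundary M x)|exact: (dtail_boundary M x)].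
apply/setP=> e; rewrite !inE; apply/idP/boundary_edgeP=> [|[y -> yf]].
  rewrite orbC -dedge_flip -in_cons -[_ :: _]/(map (@dedge G) (x :: q)).
  by case/mapP=> y; rewrite mem_xq => /eqP yf ->; exists y.
rewrite orbC -(dedge_flip d) -in_cons -[_ :: _]/(map (@dedge G) (x :: q)).
by rewrite map_f // mem_xq yf.
Qed.

(** * The faces on the outer side of the cycle, and the tree grown over them *)

Definition region : {set F} :=
  [set f | connect (crossing left chords) (outer M) f].

Lemma region_connect f f' :
  connect (crossing left chords) f f' -> f \in region -> f' \in region.
Proof. by rewrite !inE => ff' /connect_trans; apply. Qed.

(** A cycle edge has its two faces on different sides, by [sides_apart]. *)
Lemma region_inside d :
  left d \in region -> left (flip d) \in region -> dedge d \in chords.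
Proof.
rewrite chordsE !in_set connect_crossing_sym => dO Od; apply/negP=> /cycle_dartP[u du].
have /negP[] := sides_apart u; case: du dO Od => ->; rewrite ?flipK => dO Od.
  exact: connect_trans dO Od.
by rewrite connect_crossing_sym; exact: connect_trans dO Od.
Qed.

(** Both faces at [fwd u] contain [u], and one of them is on the outer side. *)
Lemma region_meets_cycle u : exists2 f, f \in region & u \in (boundary f).1.
Proof.
have [d dO] := left_surj (outer M).
case: (connect_some_side (left_face_next M) u d); rewrite dO => Ou.
  by exists (left (fwd u)); rewrite ?inE //; exact: (dtail_boundary M (fwd u)).
exists (left (flip (fwd u))); rewrite ?inE //.
exact: (dhead_boundary M (flip (fwd u))).
Qed.

(** Any two of the three darts at [v] are neighbours in the rotation, so two faces meeting at [v]
    share an edge there. *)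
Lemma shared_vertex f g v : f <> g -> v \in (boundary f).1 -> v \in (boundary g).1 ->
  exists d, [/\ left d = f, left (flip d) = g & v \in dedge d].
Proof.
move=> fg /boundary_vertexP[y -> yf] /boundary_vertexP[z yz zg].
have nyz : y <> z by move=> yz'; case: fg; rewrite -yf yz'.
have left_rot x : left (Defs.rot M x) = left (flip x).
  by rewrite -[in RHS](left_face_next M) /face_next flipK.
case: (rot_or M Gcubic yz nyz) => E.
  by exists y; rewrite yf -left_rot -E set21.
exists (flip z); rewrite flipK -left_rot -E yf dedge_flip; split=> //.
by rewrite yz set21.
Qed.

(** A run that crosses chords only. [grown_connected] yields the detours that contradict
    [chord_bridge]; [grown_rim] keeps every chord that leaves the tree on the current cycle, where
    it can be chosen. *)
Record grown (s : seq (edge G)) (sigma : subgraph G) : Prop := Grown {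
  grown_expansion : expansion M s sigma;
  grown_chords : {subset s <= chords};
  grown_region : (expansion_tree M s).1 \subset region;
  grown_connected : {in (expansion_tree M s).1 &, forall f f',
    connect (crossing left [set:: s]) f f'};
  grown_rim : forall d, left d \in (expansion_tree M s).1 ->
    left (flip d) \notin (expansion_tree M s).1 -> dedge d \in sigma.2 }.

Lemma grown_start : grown [::] (boundary (outer M)).
Proof.
have treeO : (expansion_tree M [::]).1 = [set outer M] by rewrite /= big_nil setU0.
split; rewrite ?treeO //; first exact: ExpansionStart.
- by rewrite sub1set inE connect0.
- by move=> f f' /set1P -> /set1P ->; exact: connect0.
by move=> d /set1P dO _; apply/boundary_edgeP; exists d.
Qed.

Lemma tree_dual_ends s e : e \in s -> dual_ends M e \subset (expansion_tree M s).1.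
Proof.
move=> es; apply: subset_trans (subsetUr _ _).
by elim: s es => //= e' s IHs; rewrite inE big_cons => /orP[/eqP <-|/IHs h];
  rewrite ?subsetUl // (subset_trans h) ?subsetUr.
Qed.

(** Otherwise the tree would connect both faces without this chord, contradicting [chord_bridge].
    This yields condition (2). *)
Lemma grown_bridge s sigma d : grown s sigma -> dedge d \in chords ->
  left d \in (expansion_tree M s).1 -> left (flip d) \in (expansion_tree M s).1 ->
  dedge d \in s.
Proof.
move=> gr dN dD dD'; apply: contraTT (chord_bridge dN) => nds; rewrite negbK.
apply: connect_crossingS (grown_connected gr dD dD').
apply/subsetP=> e; rewrite inE => es; rewrite in_setD1 (grown_chords gr es) andbT.
by apply: contraNneq nds => <-.
Qed.

(* Two different chords from f into the tree would close a cycle of chords.   *)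
Lemma grown_step s sigma d : grown s sigma -> dedge d \in chords ->
  left d \in (expansion_tree M s).1 ->
  left (flip d) \notin (expansion_tree M s).1 ->
  exists sigma', grown (rcons s (dedge d)) sigma'.
Proof.
move=> gr dN dD; set f := left (flip d); set D := (expansion_tree M s).1 => fD.
have [P Ppath Pf] := face_path d; rewrite -/f in Pf.
have fR : f \in region.
  apply: region_connect (connect1 (crossing_dart left dN)) _.
  exact: (subsetP (grown_region gr)).
have sD e : e \in s -> dual_ends M e \subset D by exact: tree_dual_ends.
have [sideP vertP] := expansion_sides Gcubic (grown_expansion gr).
have dsigma : dedge d \in sigma.2 by exact: (grown_rim gr).
have cP : complementary_path M sigma (dedge d) P.
  exists (dtail d), (dhead d); split=> //; last by exists f.
  apply/subsetP=> v /setIP[vP]; rewrite vertP => /bigcupP[g gD vg].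
  have vf : v \in (boundary f).1 by rewrite -Pf inE vP.
  have fg : g <> f by move=> gf; rewrite -gf gD in fD.
  have [y [yg yf vy]] := shared_vertex fg vg vf.
  have yN : dedge y \in chords.
    by apply: region_inside; rewrite ?yf // yg (subsetP (grown_region gr)).
  have [yd|nyd] := eqVneq (dedge y) (dedge d).
    by rewrite yd in vy.
  have /negP[] := chord_bridge yN; rewrite yf yg.
  apply: connect_trans (_ : connect _ g (left d)) (connect1 _); last first.
    by apply: crossing_dart; rewrite in_setD1 eq_sym nyd.
  apply: connect_crossingS (grown_connected gr gD dD).
  apply/subsetP=> e; rewrite inE => es; rewrite in_setD1 (grown_chords gr es) andbT.
  apply: contraNneq fD => ey; rewrite (subsetP (sD e es)) // ey dual_ends_dart.
  by rewrite yf set22.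
have treeE : (expansion_tree M (rcons s (dedge d))).1 = f |: D.
  rewrite expansion_tree_rcons dual_ends_dart -/D -/f setUC [[set _; f]]setUC -setUA.
  by have /setUidPr -> : [set left d] \subset D by rewrite sub1set.
exists (graph_del (graph_add sigma P) (dedge d)); split; rewrite ?treeE.
- exact: ExpansionStep (grown_expansion gr) _ cP.
- by move=> e; rewrite mem_rcons inE => /predU1P[-> //|/(grown_chords gr)].
- by rewrite subUset sub1set fR (grown_region gr).
- have toD g : g \in f |: D ->
      connect (crossing left [set:: rcons s (dedge d)]) g (left d).
    case/setU1P=> [->|gD].
      rewrite connect_crossing_sym; apply/connect1/crossing_dart.
      by rewrite inE mem_rcons mem_head.
    apply: connect_crossingS (grown_connected gr gD dD).
    by apply/subsetP=> e; rewrite !inE mem_rcons inE orbC => ->.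
  move=> g g' /toD gd /toD g'd; apply: connect_trans gd _.
  by rewrite connect_crossing_sym.
(* An edge leaving the enlarged tree already left the old one, or lies on the boundary of [f] and is
   not the crossed chord, hence is in [P]. *)
move=> y yD'; rewrite in_setU1 negb_or => /andP[yf yD]; rewrite in_setD1 in_setU.
have -> : dedge y != dedge d.
  apply/eqP=> /esym/dedge_inj[] yd; first by rewrite yd eqxx in yf.
  by rewrite yd flipK dD in yD.
case/setU1P: yD' => [yf'|/(grown_rim gr)->//].
have : dedge y \in (boundary f).2 by apply/boundary_edgeP; exists y.
rewrite -Pf !inE => /orP[-> |/eqP yd]; first by rewrite orbT.
by case: (dedge_inj yd) => dE; [rewrite -dE eqxx in yf|rewrite -dE dD in yD].
Qed.

(** Induction on the number of missing faces. When no chord leaves the tree, its faces are closed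
    under crossing chords and contain the outer face. *)
Lemma grown_region_all : exists s sigma, grown s sigma /\ (expansion_tree M s).1 = region.
Proof.
have [n] := ubnP #|region|.
suff grow m s sigma : grown s sigma -> #|region :\: (expansion_tree M s).1| < m ->
    exists s sigma, grown s sigma /\ (expansion_tree M s).1 = region.
  by move=> _; apply: (grow _ _ _ grown_start); exact: ltnSn.
elim: m s sigma => // m IHm s sigma gr; set D := (expansion_tree M s).1.
have [/eqP DR _|DR] := boolP (D == region); first by exists s, sigma.
have [d /and3P[dN dD dD']|stuck] :=
  pickP (fun d => [&& dedge d \in chords, left d \in D & left (flip d) \notin D]).
  have [sigma' gr'] := grown_step gr dN dD dD'.
  rewrite ltnS => Dm; apply: (IHm _ _ gr'); apply: leq_trans Dm.
  apply: proper_card; rewrite expansion_tree_rcons dual_ends_dart -/D.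
  apply/properP; split; first by rewrite setDS // subsetUl.
  exists (left (flip d)); rewrite in_setD; last by rewrite in_setU set22 orbT.
  rewrite dD'; apply: region_connect (connect1 (crossing_dart left dN)) _.
  exact: (subsetP (grown_region gr)).
case/eqP: DR; apply/eqP; rewrite eqEsubset (grown_region gr) /=.
apply/subsetP=> f; rewrite inE => Of.
have closedD : fingraph.closed (crossing left chords) (mem D).
  apply: intro_closed; first exact: connect_crossing_sym.
  move=> g h /existsP[d /and3P[/eqP <- /eqP <- dN]] gD.
  by have /= := stuck d; rewrite dN gD => /negbFE.
by rewrite -[f \in D](closed_connect closedD Of) setU11.
Qed.

Lemma hamiltonian_tree : exists T : dual_subgraph M,
    [/\ is_dual_tree T,
        found_by_expansion T,
        outer M \in T.1,
        forall (v : G) (f1 f2 f3 : face M),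
          [set f : face M | v \in (boundary f).1] = [set f1; f2; f3] ->
          [\/ f1 \in T.1, f2 \in T.1 | f3 \in T.1]
      & forall (f1 f2 : face M) (e : edge G),
          f1 \in T.1 -> f2 \in T.1 -> f1 <> f2 ->
          dual_joins e f1 f2 -> e \in T.2].
Proof.
have [s [sigma [gr treeE]]] := grown_region_all.
have OR : outer M \in region by rewrite inE connect0.
exists (expansion_tree M s); split.
- split=> [|e|f f' fD f'D|c cs].
  + by apply/set0Pn; exists (outer M); exact: setU11.
  + rewrite inE => es; split; last exact: tree_dual_ends.
    exact/(subsetP chords_edges)/(grown_chords gr).
  + apply: connect_sub (grown_connected gr fD f'D) => g h.
    case/existsP=> d /and3P[/eqP <- /eqP <- dA]; apply/connect1/existsP.
    by exists (dedge d); rewrite dA /dual_joins dedge_in_edges dual_ends_dart /=.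
  (* In a dual cycle the darts after the first bypass its chord, which is a bridge. *)
  case: c cs => [|d c] cs //; rewrite /dual_cycle /=.
  apply/negP=> /and3P[pc _ /andP[dc _]].
  have dN : dedge d \in chords.
    by apply: (grown_chords gr); have := cs d (mem_head _ _); rewrite inE.
  have /negP[] := chord_bridge dN; rewrite connect_crossing_sym.
  apply: dual_path_crossing pc _ => y yc; rewrite in_setD1; apply/andP; split.
    by apply: contraNneq dc => <-; exact: map_f.
  by apply: (grown_chords gr); have := cs y; rewrite !inE yc orbT => ->.
- exists s, sigma; split=> //; split; first exact: grown_expansion.
  (* The run has ended: the cycle visits every vertex, and a complementary path would need another
     one. *)
  case=> e [P [_ /(complementary_path_leaves Gcubic)/negP[]]].
  have [_ ->] := expansion_sides Gcubic (grown_expansion gr).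
  apply/subsetP=> v _; have [f fR vf] := region_meets_cycle v.
  by apply/bigcupP; exists f; rewrite ?treeE.
- exact: setU11.
- move=> v f1 f2 f3 faces; have [f fR] := region_meets_cycle v.
  have -> : (v \in (boundary f).1) = (f \in [set f1; f2; f3]) by rewrite -faces inE.
  rewrite treeE !inE -orbA => /or3P[] /eqP <-; [apply: Or31|apply: Or32|apply: Or33];
  by rewrite inE in fR.
move=> f1 f2 e f1D f2D f12 /andP[/edgesP[d ->]]; rewrite dual_ends_dart inE.
move=> /eqP/eq_set2 ends.
have {f12 ends}[dD dD'] : left d \in (expansion_tree M s).1 /\
    left (flip d) \in (expansion_tree M s).1 by case: ends => -[-> ->].
apply: (grown_bridge gr) => //; rewrite treeE in dD dD'; exact: region_inside.
Qed.

End HamiltonianDual.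

(** * Replacing an edge of a cycle by a path *)

Section CycleSurgery.
Variable G : sgraph.
Implicit Types (x y z u : G) (p q : seq G) (e : edge G).

Definition walk_edges x p : seq (edge G) := pairmap (fun u v => [set u; v]) x p.

Lemma walk_edges_cat x p q :
  walk_edges x (p ++ q) = walk_edges x p ++ walk_edges (last x p) q.
Proof. exact: pairmap_cat. Qed.

Lemma walk_edges_sub x p e u : e \in walk_edges x p -> u \in e -> u \in x :: p.
Proof.
elim: p x => //= y p IHp x; rewrite inE => /predU1P[->|/IHp ep].
  by case/set2P=> ->; rewrite !inE eqxx ?orbT.
by move=> /ep uyp; rewrite in_cons uyp orbT.
Qed.

Lemma walk_edges_split x p e : e \in walk_edges x p ->
  exists p1 z p2, p = p1 ++ z :: p2 /\ e = [set last x p1; z].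
Proof.
elim: p x => //= y p IHp x; rewrite inE => /predU1P[->|/IHp[p1 [z [p2 [-> ->]]]]].
  by exists [::], y, p.
by exists (y :: p1), z, p2.
Qed.

(** The start of a simple path lies on its first edge only, so an edge joining both ends is the
    first and reaches the last vertex. *)
Lemma uniq_path_ends_edge x p :
  uniq (x :: p) -> [set x; last x p] \in walk_edges x p -> size p <= 1.
Proof.
case: p => //= y p /andP[xyp Uyp]; rewrite inE => /predU1P[/eq_set2|xe]; last first.
  by rewrite (walk_edges_sub xe (set21 _ _)) in xyp.
case=> [[_ ly]|[xy _]]; last by rewrite xy mem_head in xyp.
by case: p ly Uyp {xyp} => //= z p <-; rewrite mem_last.
Qed.

Lemma walk_edges_rev x p :
  walk_edges (last x p) (rev (belast x p)) = rev (walk_edges x p).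
Proof.
elim: p x => //= y p IHp x; rewrite !rev_cons -cats1 walk_edges_cat IHp cats1.
congr rcons; rewrite setUC.
by case: p {IHp} => //= z p; rewrite rev_cons last_rcons.
Qed.

Lemma is_path_sym x y (P : subgraph G) : is_path x y P -> is_path y x P.
Proof.
case=> p [pp Up <- ->]; exists (rev (belast x p)).
have revE : last x p :: rev (belast x p) = rev (x :: p) by rewrite [in RHS]lastI rev_rcons.
split.
- by rewrite rev_path (eq_path (e' := @adj G)) // => u v; exact: adj_sym.
- by rewrite revE rev_uniq.
- by case: p {pp Up revE} => //= z p; rewrite rev_cons last_rcons.
rewrite /walk_graph revE -![pairmap _ _ _]/(walk_edges _ _) walk_edges_rev.
by congr pair; apply/setP=> u; rewrite !inE mem_rev.
Qed.

(** The cycle is cut at [e] and rotated: [q] is the part after [e] followed by the part before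
    it. *)
Lemma cycle_open (C : subgraph G) e : is_cycle C -> e \in C.2 ->
  exists y z q, [/\ e = [set y; z], C = walk_graph y (z :: q),
    path (@adj G) z q, last z q = y & uniq (z :: q) /\ 1 < size q].
Proof.
case=> x [p [cp Up szp ->]]; rewrite inE => /walk_edges_split[p1 [z [p2 [pE ->]]]].
have lastx : last z p2 = x by rewrite -(last_rcons x p x) pE last_cat.
exists (last x p1), z, (p2 ++ p1); rewrite last_cat lastx; split=> //.
- have edgesE : walk_edges (last x p1) (z :: p2 ++ p1) =
      walk_edges (last x p1) (z :: p2) ++ walk_edges x p1.
    by rewrite -cat_cons walk_edges_cat /= lastx.
  rewrite pE /walk_graph -[pairmap _ _ (z :: _)]/(walk_edges _ _) edgesE.
  rewrite -[pairmap _ _ _]/(walk_edges _ _) walk_edges_cat.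
  congr pair; apply/setP=> u; rewrite !inE !mem_cat ?inE ?mem_cat; last first.
    by rewrite orbC -orbA.
  have := mem_last x p1; have := mem_last z p2; rewrite lastx !inE => xz lx.
  have [->|_] := eqVneq u x; first by case/orP: xz => ->; rewrite ?orbT.
  have [->|_] /= := eqVneq u (last x p1).
    by case/orP: lx => [/eqP->|->]; rewrite ?orbT //; case/orP: xz => ->; rewrite ?orbT.
  by rewrite orbC -orbA.
- move: cp; rewrite /= pE cat_path /= => /and3P[p1p _ p2p].
  by rewrite cat_path p2p lastx.
split; last by rewrite -ltnS -[X in _ < X]/(size ((z :: p2) ++ p1)) size_cat addnC
  -size_cat -pE size_rcons.
by rewrite -cat_cons uniq_catC -pE rcons_uniq.
Qed.

(** Deleting the edge must remove nothing else from the new cycle. The path does not contain it,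
    since it leaves [sigma]; the rest of [sigma] does not, having more than one edge. *)
Lemma cycle_reroute (sigma P : subgraph G) v1 v2 :
  is_cycle sigma -> [set v1; v2] \in sigma.2 -> is_path v1 v2 P ->
  P.1 :&: sigma.1 \subset [set v1; v2] -> ~~ (P.1 \subset sigma.1) ->
  is_cycle (graph_del (graph_add sigma P) [set v1; v2]).
Proof.
move=> cyc e_sigma Ppath; have [y [z [q]]] := cycle_open cyc e_sigma.
case=> eE -> qp lq [Uq szq]; have [p [pp Up lp ->]] : is_path y z P.
  case/eq_set2: eE => -[v1E v2E]; first by rewrite -v1E -v2E.
  by rewrite -v1E -v2E; exact: is_path_sym.
rewrite eE => int12 leaves {cyc e_sigma Ppath}.
have zp : z \in p.
  have /predU1P[zy|//] : z \in y :: p by rewrite -lp mem_last.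
  by case: q lq Uq szq {qp int12 leaves} => //= w q lq; rewrite zy -{1}lq mem_last.
have e_q : [set y; z] \notin walk_edges z q.
  by apply: contraL szq; rewrite -leqNgt setUC -{1}lq; exact: uniq_path_ends_edge.
have e_p : [set y; z] \notin walk_edges y p.
  apply: contra leaves; rewrite -{1}lp => /(uniq_path_ends_edge Up) szp.
  case: p zp szp {pp Up lp int12} => [|a []] //=; rewrite inE => /eqP <- _.
  by apply/subsetP=> u; rewrite !inE => /orP[] ->; rewrite ?orbT.
have edgesE : walk_edges y (p ++ q) = walk_edges y p ++ walk_edges z q.
  by rewrite walk_edges_cat lp.
(* The last vertex of [q] is [y], which already opens the new cycle [y :: p ++ q']. *)
case/lastP: q qp lq Uq szq int12 e_q edgesE {leaves} => // q' w.
rewrite last_rcons size_rcons => qp wy; subst w => Uq szq int12 e_q edgesE.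
move: (Uq); rewrite /= mem_rcons inE negb_or rcons_uniq => /and3P[/andP[zy zq'] yq' Uq'].
exists y, (p ++ q'); split.
- by rewrite /= rcons_cat cat_path pp lp.
- move: Up; rewrite /= cat_uniq Uq' mem_cat negb_or yq' andbT.
  move=> /andP[-> ->] /=; rewrite andbT; apply/hasPn=> u uq'; apply/negP=> up.
  have : u \in [set y; z].
    apply: (subsetP int12); rewrite !inE (mem_rcons q') !inE uq' up !orbT.
    by [].
  by case/set2P=> uE; rewrite uE ?(negPf yq') ?(negPf zq') in uq'.
- have : 0 < size p by case: (p) zp.
  by rewrite /= size_cat; lia.
rewrite rcons_cat; congr pair; apply/setP=> u.
  rewrite !inE mem_cat mem_rcons inE.
  have [->|_] := eqVneq u z; first by rewrite zp !orbT.
  by case: (u == y) => //=; rewrite orbC.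
rewrite -[pairmap _ y (p ++ _)]/(walk_edges _ _) edgesE !inE mem_cat.
rewrite -![pairmap _ _ _]/(walk_edges _ _).
have [->|_] /= := eqVneq u [set y; z]; first by rewrite (negPf e_p) (negPf e_q).
by rewrite orbC.
Qed.

End CycleSurgery.

(** * The two implications *)

Lemma hamiltonian_next (G : sgraph) : hamiltonian G ->
  exists nx : G -> G, [/\ injective nx, forall u, adj u (nx u),
    forall u, nx (nx u) != u & forall u v, fconnect nx u v].
Proof.
case=> C [[x [p [cp Up szp ->]]] /setP allC].
have allp u : u \in x :: p by have := allC u; rewrite !inE mem_rcons inE orbA orbb.
exists (next (x :: p)); split.
- exact: can_inj (prev_next Up).
- by move=> u; exact: next_cycle.
(* After rotating [u] to the front, length at least three puts two further vertices after it. *)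
- move=> u; have [i q pE] := rot_to (allp u); rewrite -!(next_rot i Up) pE.
  move: Up szp; rewrite -(rot_uniq i) -(size_rot i) pE.
  case: q {pE} => [|a [|b q]] //= + _; rewrite !eqxx !inE !negb_or.
  by case/andP=> /and3P[ua ub _] _; rewrite (eq_sym a) (negPf ua) eq_sym.
by move=> u v; rewrite (fconnect_cycle (cycle_next Up) (allp u)) allp.
Qed.

Lemma expansion_cycle (G : sgraph) (M : plane_embedding G) s sigma :
  cubic G -> is_cycle (boundary (outer M)) -> expansion M s sigma ->
  is_cycle sigma.
Proof.
move=> Gcubic outer_cycle; elim=> // {}s {}sigma e P _ cyc e_sigma cP.
have leaves := complementary_path_leaves Gcubic cP.
by case: cP e_sigma => v1 [v2] [-> Ppath int12 _] e_sigma; exact: cycle_reroute.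
Qed.

Theorem theorem3p6 (G : sgraph) (M : plane_embedding G)
    (Gcubic : cubic G)
    (outer_cycle : is_cycle (boundary (outer M))) :
  hamiltonian G <->
  exists T : dual_subgraph M,
    [/\ is_dual_tree T,
        found_by_expansion T,
        outer M \in T.1,
        forall (v : G) (f1 f2 f3 : face M),
          [set f : face M | v \in (boundary f).1] = [set f1; f2; f3] ->
          [\/ f1 \in T.1, f2 \in T.1 | f3 \in T.1]
      & forall (f1 f2 : face M) (e : edge G),
          f1 \in T.1 -> f2 \in T.1 -> f1 <> f2 ->
          dual_joins e f1 f2 -> e \in T.2].
Proof.
split=> [/hamiltonian_next[nx [nx_inj nx_adj nx_nx nx_connect]]|].
  exact: hamiltonian_tree nx_connect.
case=> T [_ [s [sigma [[run _] ->]]] _ covers _].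
exists sigma; split; first exact: expansion_cycle run.
have [_ ->] := expansion_sides Gcubic run.
apply/setP=> v; rewrite inE; apply/bigcupP.
have [w vw] : exists w, adj v w.
  have /card_gt0P[w] : 0 < #|[set u | adj v u]| by rewrite Gcubic.
  by rewrite inE; exists w.
pose d : dart G := exist (fun a : G * G => adj a.1 a.2) (v, w) vw.
pose d' := Defs.rot M d; pose d'' := Defs.rot M d'.
have tails : dtail d' = v /\ dtail d'' = v by rewrite !dtail_rot.
(* The faces left of the three darts at [v] are those to which condition (1) applies. *)
have around : [set f : face M | v \in (boundary f).1] =
    [set Defs.left M d; Defs.left M d'; Defs.left M d''].
  apply/setP=> f; rewrite !inE -orbA.
  apply/boundary_vertexP/or3P=> [[y vy <-]|].
    case: (rot_cases M Gcubic (vy : dtail d = dtail y)) => ->;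
      by [apply: Or31|apply: Or32|apply: Or33].
  by case: tails => t' t'' [] /eqP ->; [exists d|exists d'|exists d''].
case: (covers v _ _ _ around) => dT; [exists (Defs.left M d)|exists (Defs.left M d')
  |exists (Defs.left M d'')]; rewrite //.
- exact: (dtail_boundary M d).
- by case: tails => <- _; exact: dtail_boundary.
by case: tails => _ <-; exact: dtail_boundary.
Qed.
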